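(* Let $\widehat{A}=A+\varepsilon B$ be an $n\times n$ symmetric dual matrix (i.e. $\widehat{A}^{T}=\widehat{A}$) with $A,B\in\mathbb{R}^{n\times n}$. Then the following conditions are equivalent: (1) the dual core generalized inverse $\widehat{A}^{\mathrm{c}}$ of $\widehat{A}$ exists, and $\widehat{A}^{\mathrm{c}}=\widehat{A}^{\#}=\widehat{A}^{+}=\widehat{A}^{\mathrm{P}}=A^{+}-\varepsilon A^{+}BA^{+}$; (2) $(I_n-AA^{+})B=0$ or $(I_n-AA^{\#})B=0$ or $(I_n-AA^{\mathrm{c}})B=0$; (3) $\mathrm{rank}\left(\begin{bmatrix}A & B\end{bmatrix}\right)=\mathrm{rank}(A)$; (4) $\mathcal{R}(B)\subseteq\mathcal{R}(A)$; (5) $B(I_n-AA^{+})=0$ or $B(I_n-AA^{\#})=0$ or $B(I_n-AA^{\mathrm{c}})=0$.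
   Context: Dual numbers are $a+\varepsilon a'$ with $a,a'\in\mathbb{R}$ and $\varepsilon\neq 0$, $\varepsilon^2=0$ (i.e. the ring $\mathbb{R}[\varepsilon]/(\varepsilon^2)$). A dual matrix is a matrix over dual numbers, written $\widehat{A}=A+\varepsilon B$ with $A,B$ real; its transpose is $\widehat{A}^{T}=A^{T}+\varepsilon B^{T}$. For an $n\times n$ dual matrix $\widehat{A}$ (each of the first three inverses is unique when it exists): the dual group generalized inverse $\widehat{A}^{\#}$ is the $\widehat{G}$ with $\widehat{A}\widehat{G}\widehat{A}=\widehat{A}$, $\widehat{G}\widehat{A}\widehat{G}=\widehat{G}$, $\widehat{A}\widehat{G}=\widehat{G}\widehat{A}$; the dual Moore–Penrose generalized inverse $\widehat{A}^{+}$ is the $\widehat{X}$ with $\widehat{A}\widehat{X}\widehat{A}=\widehat{A}$, $\widehat{X}\widehat{A}\widehat{X}=\widehat{X}$, $(\widehat{A}\widehat{X})^{T}=\widehat{A}\widehat{X}$, $(\widehat{X}\widehat{A})^{T}=\widehat{X}\widehat{A}$; the dual core generalized inverse $\widehat{A}^{\mathrm{c}}$ is the $\widehat{G}$ with $\widehat{A}\widehat{G}\widehat{A}=\widehat{A}$, $\widehat{A}\widehat{G}^2=\widehat{G}$, $(\widehat{A}\widehat{G})^{T}=\widehat{A}\widehat{G}$; the Moore–Penrose dual generalized inverse (MPDGI), which always exists, is by definition $\widehat{A}^{\mathrm{P}}=A^{+}-\varepsilon A^{+}BA^{+}$. For the real matrix $A$, $A^{\#}$, $A^{+}$, $A^{\mathrm{c}}$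 are its group, Moore–Penrose and core inverses, defined by the same respective equations over $\mathbb{R}$; since $A$ is symmetric they all exist and coincide. $\mathcal{R}(\cdot)$ denotes the range (column space). *)

(* Defs.v *)
From HB Require Import structures.
From mathcomp Require Import all_boot all_order all_algebra.
From mathcomp Require Import boolp classical_sets reals.

Set Implicit Arguments.
Unset Strict Implicit.
Unset Printing Implicit Defensive.
Import Order.TTheory GRing.Theory Num.Theory.
Local Open Scope ring_scope.

Record dual (R : Type) : Type := Dual { rpart : R; dpart : R }.

Definition dual_to_pair (R : Type) (x : dual R) : R * R := (rpart x, dpart x).
Definition dual_of_pair (R : Type) (x : R * R) : dual R := Dual x.1 x.2.

Lemma dual_to_pairK (R : Type) :
  cancel (@dual_to_pair R) (@dual_of_pair R).
Proof. by case. Qed.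

HB.instance Definition _ (R : eqType) :=
  Equality.copy (dual R) (can_type (@dual_to_pairK R)).
HB.instance Definition _ (R : choiceType) :=
  Choice.copy (dual R) (can_type (@dual_to_pairK R)).

Section DualRing.
Variable R : comNzRingType.
Implicit Types x y z : dual R.

Definition dual_zero : dual R := Dual 0 0.
Definition dual_one : dual R := Dual 1 0.
Definition dual_opp x : dual R := Dual (- rpart x) (- dpart x).
Definition dual_add x y : dual R := Dual (rpart x + rpart y) (dpart x + dpart y).
Definition dual_mul x y : dual R :=
  Dual (rpart x * rpart y) (rpart x * dpart y + dpart x * rpart y).

Fact dual_addA : associative dual_add.
Proof. by move=> x y z; rewrite /dual_add /= !addrA. Qed.
Fact dual_addC : commutative dual_add.
Proof. by move=> x y; rewrite /dual_add addrC [dpart x + _]addrC. Qed.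
Fact dual_add0 : left_id dual_zero dual_add.
Proof. by case=> a b; rewrite /dual_add /= !add0r. Qed.
Fact dual_addN : left_inverse dual_zero dual_opp dual_add.
Proof. by move=> x; rewrite /dual_add /= !addNr. Qed.

HB.instance Definition _ := GRing.isZmodule.Build (dual R)
  dual_addA dual_addC dual_add0 dual_addN.

Fact dual_mulA : associative dual_mul.
Proof.
by move=> x y z; rewrite /dual_mul /= mulrDr mulrDl !mulrA addrA.
Qed.
Fact dual_mulC : commutative dual_mul.
Proof.
move=> x y; rewrite /dual_mul [rpart x * rpart y]mulrC addrC.
by rewrite [dpart x * _]mulrC [rpart x * _]mulrC.
Qed.
Fact dual_mul1 : left_id dual_one dual_mul.
Proof. by case=> a b; rewrite /dual_mul /= !mul1r mul0r addr0. Qed.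
Fact dual_mulD : left_distributive dual_mul dual_add.
Proof.
by move=> x y z; rewrite /dual_mul /dual_add /= !mulrDl addrACA.
Qed.
Fact dual_one_neq0 : dual_one != dual_zero.
Proof. by apply/eqP => -[/eqP]; rewrite oner_eq0. Qed.

HB.instance Definition _ := GRing.Zmodule_isComNzRing.Build (dual R)
  dual_mulA dual_mulC dual_mul1 dual_mulD dual_one_neq0.

Definition eps : dual R := Dual 0 1.
Definition dualC (a : R) : dual R := Dual a 0.

Lemma eps_neq0 : eps != 0.
Proof. by apply/eqP => -[/eqP]; rewrite oner_eq0. Qed.

Lemma eps_sqr : eps * eps = 0.
Proof. by congr Dual; rewrite /= ?mul0r ?mulr0 ?addr0. Qed.

Lemma dualE (a b : R) : Dual a b = dualC a + eps * dualC b.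
Proof.
by congr Dual; rewrite /= ?mul0r ?mulr0 ?mul1r ?addr0 ?add0r.
Qed.

End DualRing.

Arguments eps {R}.

Section DualMatrix.
Variables (R : comNzRingType) (m n : nat).

Definition dualmx (A : 'M[R]_(m, n)) : 'M[dual R]_(m, n) :=
  map_mx (@dualC R) A.
Definition rpartmx (Ah : 'M[dual R]_(m, n)) : 'M[R]_(m, n) :=
  map_mx (@rpart R) Ah.
Definition dpartmx (Ah : 'M[dual R]_(m, n)) : 'M[R]_(m, n) :=
  map_mx (@dpart R) Ah.

Lemma dualmxE (Ah : 'M[dual R]_(m, n)) :
  Ah = dualmx (rpartmx Ah) + eps *: dualmx (dpartmx Ah).
Proof. by apply/matrixP => i j; rewrite !mxE -dualE; case: (Ah i j). Qed.

Lemma rpartmx_dual (A B : 'M[R]_(m, n)) :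
  rpartmx (dualmx A + eps *: dualmx B) = A.
Proof. by apply/matrixP => i j; rewrite !mxE /= mul0r addr0. Qed.

Lemma dpartmx_dual (A B : 'M[R]_(m, n)) :
  dpartmx (dualmx A + eps *: dualmx B) = B.
Proof. by apply/matrixP => i j; rewrite !mxE /= !mul0r mul1r !add0r. Qed.

End DualMatrix.

(* Stated over an arbitrary ring, so that the same equations define the real
   and the dual inverses. *)
Section GeneralizedInverse.
Variables (S : comNzRingType) (n : nat).
Implicit Types A G X : 'M[S]_n.

Definition is_group_inverse A G : Prop :=
  [/\ A *m G *m A = A, G *m A *m G = G & A *m G = G *m A].

Definition is_mp_inverse A X : Prop :=
  [/\ A *m X *m A = A, X *m A *m X = X,
      (A *m X)^T = A *m X & (X *m A)^T = X *m A].

Definition is_core_inverse A G : Prop :=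
  [/\ A *m G *m A = A, A *m (G *m G) = G & (A *m G)^T = A *m G].

End GeneralizedInverse.

Section RealGeneralizedInverse.
Variables (R : realType) (n : nat).
Implicit Types A : 'M[R]_n.

(* [xget] returns the matrix satisfying the defining equations when there is
   one, and the zero matrix otherwise; [symmx_inverses] below shows that the
   default is never reached when A is symmetric. *)
Definition ginv A : 'M[R]_n := xget 0 [set G | is_group_inverse A G]%classic.
Definition mpinv A : 'M[R]_n := xget 0 [set X | is_mp_inverse A X]%classic.
Definition cinv A : 'M[R]_n := xget 0 [set G | is_core_inverse A G]%classic.

Lemma symmx_factor A : A^T = A -> exists Y, A = A *m A *m Y.
Proof.
move=> sA; suff /submxP[Y eY] : (A <= A *m A)%MS.
  by exists Y^T; rewrite -{1}sA {1}eY !trmx_mul sA.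
have sub : (A *m A <= A)%MS by exact: submxMl.
rewrite -(geq_leqif (mxrank_leqif_sup sub)).
have /mxrankS : (kermx (A *m A) <= kermx A)%MS.
  apply/rV_subP => u; rewrite !sub_kermx => /eqP uAA.
  have /matrixP/(_ 0 0) : (u *m A) *m (u *m A)^T = 0.
    by rewrite trmx_mul sA mulmxA -[u *m A *m A]mulmxA uAA mul0mx.
  rewrite !mxE => /eqP; rewrite psumr_eq0 => [/allP h|i _]; last first.
    by rewrite [(_)^T _ _]mxE -expr2 sqr_ge0.
  apply/eqP/rowP => j; rewrite [RHS]mxE; apply/eqP.
  have := h j (mem_index_enum j).
  by rewrite [(_)^T _ _]mxE mulf_eq0 orbb.
rewrite !mxrank_ker; have := rank_leq_row A.
have := rank_leq_row (A *m A).
move: (\rank A) (\rank (A *m A)) => a b hb ha.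
by rewrite leq_sub2lE.
Qed.

Lemma symmx_inverse_ex A : A^T = A ->
  exists G, [/\ is_group_inverse A G, is_mp_inverse A G & is_core_inverse A G].
Proof.
move=> sA; have [Y eY] := symmx_factor sA.
have eYt : A = Y^T *m A *m A by rewrite -{1}sA {1}eY !trmx_mul sA mulmxA.
have eP : Y^T *m A = A *m Y by rewrite {1}eY !mulmxA -eYt.
have PA : A *m Y *m A = A by rewrite -eP -eYt.
have PP : A *m Y *m (A *m Y) = A *m Y by rewrite mulmxA PA.
have sP : (A *m Y)^T = A *m Y by rewrite trmx_mul sA eP.
pose G := A *m Y *m Y.
have AG : A *m G = A *m Y by rewrite /G !mulmxA -eY.
have GA : G *m A = A *m Y.
  by rewrite /G -{1}eP -mulmxA -mulmxA (mulmxA A Y A) PA eP.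
have PG : A *m Y *m G = G by rewrite /G mulmxA PP.
have GAG : G *m A *m G = G by rewrite GA PG.
have AGG : A *m (G *m G) = G by rewrite mulmxA AG PG.
by exists G; do 2?split; rewrite ?GAG ?AGG ?AG ?GA ?PA ?sP.
Qed.

Lemma symmx_inverses A : A^T = A ->
  [/\ is_group_inverse A (ginv A), is_mp_inverse A (mpinv A)
     & is_core_inverse A (cinv A)].
Proof.
by move=> /symmx_inverse_ex[G [gG mG cG]]; split; apply: xgetPex; exists G.
Qed.

Definition colrange m (A : 'M[R]_(n, m)) : set 'cV[R]_n :=
  range (fun x : 'cV[R]_m => A *m x).

(* The Moore-Penrose dual generalized inverse of Ah = A + eps B. *)
Definition mpdgi (Ah : 'M[dual R]_n) : 'M[dual R]_n :=
  let A := rpartmx Ah in let B := dpartmx Ah in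
  dualmx (mpinv A) - eps *: dualmx (mpinv A *m B *m mpinv A).

End RealGeneralizedInverse.

(* Main.v *)
(* With X = A^+, all three real inverses give the same orthogonal projector
   P = A X = X A onto the range of A. Put G = Ah^P and Q = I - P, so that
   Q A = Q X = 0. Multiplying on the left by Q, the dual part of Ah G = G Ah
   gives Q B X = 0, and the dual part of Ah G Ah = Ah gives Q B X A = Q B;
   hence Q B = 0. Conversely, Q B = 0 and the symmetry of B yield
   P B = B = B P, and then G satisfies all the defining equations. *)
Require Import Defs.
From mathcomp Require Import all_boot all_order all_algebra.
From mathcomp Require Import boolp classical_sets reals.
Import Order.TTheory GRing.Theory Num.Theory.
Local Open Scope ring_scope.

Set Implicit Arguments.
Unset Strict Implicit.
Unset Printing Implicit Defensive.

(** * Real and dual parts of matrix products and transposes *)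

Section DualMatrixParts.
Variable S : comNzRingType.

Lemma rpartmxM m n p (M : 'M[dual S]_(m, n)) (N : 'M[dual S]_(n, p)) :
  rpartmx (M *m N) = rpartmx M *m rpartmx N.
Proof.
apply/matrixP => i j; rewrite !mxE.
rewrite (big_morph (@rpart S) (id1 := 0) (op1 := +%R)) //.
by apply: eq_bigr => k _; rewrite !mxE.
Qed.

Lemma dpartmxM m n p (M : 'M[dual S]_(m, n)) (N : 'M[dual S]_(n, p)) :
  dpartmx (M *m N) = rpartmx M *m dpartmx N + dpartmx M *m rpartmx N.
Proof.
apply/matrixP => i j; rewrite !mxE.
rewrite (big_morph (@dpart S) (id1 := 0) (op1 := +%R)) // -big_split.
by apply: eq_bigr => k _; rewrite !mxE.
Qed.

Lemma rpartmx_tr m n (M : 'M[dual S]_(m, n)) : rpartmx M^T = (rpartmx M)^T.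
Proof. by apply/matrixP => i j; rewrite !mxE. Qed.

Lemma dpartmx_tr m n (M : 'M[dual S]_(m, n)) : dpartmx M^T = (dpartmx M)^T.
Proof. by apply/matrixP => i j; rewrite !mxE. Qed.

Lemma dualmx_eq m n (M N : 'M[dual S]_(m, n)) :
  rpartmx M = rpartmx N -> dpartmx M = dpartmx N -> M = N.
Proof. by move=> er ed; rewrite (dualmxE M) er ed -dualmxE. Qed.

End DualMatrixParts.

(** * Uniqueness of projectors and of the Moore-Penrose inverse *)

Section Projectors.
Variables (S : comNzRingType) (n : nat).
Implicit Types A G H X Y : 'M[S]_n.

(** [A G = (A H A G)^T = A G A H = A H]. The hypotheses are shared by Moore-Penrose and core
    inverses. *)
Lemma sym_left_projector_uniq A G H :
  A *m G *m A = A -> (A *m G)^T = A *m G ->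
  A *m H *m A = A -> (A *m H)^T = A *m H -> A *m G = A *m H.
Proof.
move=> AGA sG AHA sH.
by rewrite -sG -{1}AHA -[A *m H *m A *m G]mulmxA trmx_mul sG sH mulmxA AGA.
Qed.

Lemma mp_inverse_uniq A X Y :
  is_mp_inverse A X -> is_mp_inverse A Y -> X = Y.
Proof.
case=> AXA XAX sAX sXA [AYA YAY sAY sYA].
have eAX : A *m X = A *m Y by exact: sym_left_projector_uniq.
have eXA : X *m A = Y *m A.
  (* Transposition makes [X A] a left projector of [A^T]. *)
  apply: trmx_inj; rewrite !trmx_mul; apply: sym_left_projector_uniq.
  - by rewrite -!trmx_mul mulmxA AXA.
  - by rewrite -trmx_mul sXA.
  - by rewrite -!trmx_mul mulmxA AYA.
  - by rewrite -trmx_mul sYA.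
by rewrite -XAX eXA -mulmxA eAX mulmxA.
Qed.

(** Commutation gives [A H = A G A H = G A H A = G A = A G]. *)
Lemma group_projector_uniq A G H :
  is_group_inverse A G -> is_group_inverse A H -> A *m G = A *m H.
Proof.
case=> AGA _ cG [AHA _ cH].
rewrite -{2}AGA -[A *m G *m A *m H]mulmxA cH cG -!mulmxA.
by rewrite [A *m (H *m A)]mulmxA AHA.
Qed.

End Projectors.

Section SymmetricInverses.
Variables (R : realType) (n : nat) (A : 'M[R]_n).
Hypothesis sA : A^T = A.

(** A single matrix is an inverse of all three kinds; uniqueness identifies it with [mpinv A]. *)
Lemma symmx_mpinv :
  [/\ is_group_inverse A (mpinv A), is_mp_inverse A (mpinv A)
    & is_core_inverse A (mpinv A)].
Proof.
have [_ mA _] := symmx_inverses sA.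
have [G [gG mG cG]] := symmx_inverse_ex sA.
by rewrite (mp_inverse_uniq mA mG).
Qed.

Lemma symmx_ginv_projector : A *m ginv A = A *m mpinv A.
Proof.
have [gA _ _] := symmx_inverses sA; have [gX _ _] := symmx_mpinv.
exact: group_projector_uniq.
Qed.

Lemma symmx_cinv_projector : A *m cinv A = A *m mpinv A.
Proof.
have [_ _ [ACA _ sC]] := symmx_inverses sA.
have [_ _ [AXA _ sX]] := symmx_mpinv.
exact: sym_left_projector_uniq.
Qed.

End SymmetricInverses.

(** * The dual inverse [mpdgi Ah] *)

Section DualInverse.
Variables (R : realType) (n : nat) (A B : 'M[R]_n).
Hypothesis sA : A^T = A.
Let Ah : 'M[dual R]_n := dualmx A + eps *: dualmx B.
Let X := mpinv A.

Lemma mpdgiE : mpdgi Ah = dualmx X - eps *: dualmx (X *m B *m X).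
Proof. by rewrite /mpdgi rpartmx_dual dpartmx_dual. Qed.

Lemma rpartmx_mpdgi : rpartmx (mpdgi Ah) = X.
Proof.
rewrite mpdgiE -scalerN; apply/matrixP => i j.
by rewrite !mxE /= mul0r addr0.
Qed.

Lemma dpartmx_mpdgi : dpartmx (mpdgi Ah) = - (X *m B *m X).
Proof.
rewrite mpdgiE -scalerN; apply/matrixP => i j.
by rewrite !mxE /= mul0r mul1r !add0r.
Qed.

Lemma mpdgi_group_inverse_range :
  is_group_inverse Ah (mpdgi Ah) -> (1%:M - A *m X) *m B = 0.
Proof.
have [[AXA _ _] _ [_ AXX _]] := symmx_mpinv sA; rewrite -/X in AXA AXX.
set Q : 'M[R]_n := 1%:M - A *m X.
have QA : Q *m A = 0 by rewrite mulmxBl mul1mx AXA subrr.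
have QX : Q *m X = 0 by rewrite -AXX (mulmxA Q A) QA mul0mx.
clearbody Q.
have [rG dG] := (rpartmx_mpdgi, dpartmx_mpdgi).
have [rA dA] : rpartmx Ah = A /\ dpartmx Ah = B.
  by rewrite rpartmx_dual dpartmx_dual.
(* Abstracting both dual matrices leaves only their real and dual parts for rewriting. *)
move: (mpdgi Ah) rG dG => G rG dG; move: Ah rA dA => Mh rA dA.
case=> /(congr1 (@dpartmx _ _ _)) eB _ /(congr1 (@dpartmx _ _ _)) eC.
have QBX : Q *m B *m X = 0.
  move: eC; rewrite !dpartmxM rA rG dA dG => /(congr1 (mulmx Q)).
  rewrite !mulmxDr !mulmxN !mulNmx !mulmxN !mulmxA.
  by rewrite QA QX !mul0mx oppr0 !add0r.
move: eB; rewrite !dpartmxM rpartmxM rA rG dA dG => <-.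
by rewrite mulmxDr !mulmxA mulmxDr !mulmxA QA QBX !mul0mx !add0r mul0mx.
Qed.

Hypotheses (AXB : A *m X *m B = B) (BXA : B *m X *m A = B).

(** The dual part of [Ah G] is [B X - A X B X = 0], and that of [G Ah] is [X B - X B X A = 0], so
    both products equal the real projector [A X]. *)
Lemma mpdgi_inverses :
  [/\ is_core_inverse Ah (mpdgi Ah), is_group_inverse Ah (mpdgi Ah)
    & is_mp_inverse Ah (mpdgi Ah)].
Proof.
have [[AXA XAX cAX] _ [_ AXX sAX]] := symmx_mpinv sA.
rewrite -/X in AXA XAX cAX AXX sAX.
have [rG dG] := (rpartmx_mpdgi, dpartmx_mpdgi).
have [rA dA] : rpartmx Ah = A /\ dpartmx Ah = B.
  by rewrite rpartmx_dual dpartmx_dual.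
move: (mpdgi Ah) rG dG => G rG dG; move: Ah rA dA => Mh rA dA.
have AG : Mh *m G = dualmx (A *m X) + eps *: dualmx 0.
  apply: dualmx_eq; rewrite ?rpartmx_dual ?dpartmx_dual.
    by rewrite rpartmxM rA rG.
  by rewrite dpartmxM rA rG dA dG mulmxN !mulmxA AXB addNr.
have GA : G *m Mh = Mh *m G.
  rewrite AG; apply: dualmx_eq; rewrite ?rpartmx_dual ?dpartmx_dual.
    by rewrite rpartmxM rA rG cAX.
  by rewrite dpartmxM rA rG dA dG mulNmx -!mulmxA (mulmxA B) BXA subrr.
have AGA : Mh *m G *m Mh = Mh.
  rewrite AG; apply: dualmx_eq.
    by rewrite rpartmxM rpartmx_dual rA AXA.
  by rewrite dpartmxM rpartmx_dual dpartmx_dual dA mul0mx addr0 AXB.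
have AGG : Mh *m G *m G = G.
  rewrite AG; apply: dualmx_eq.
    by rewrite rpartmxM rpartmx_dual rG -mulmxA AXX.
  rewrite dpartmxM rpartmx_dual dpartmx_dual dG mul0mx addr0 mulmxN !mulmxA.
  by rewrite -[A *m X *m X]mulmxA AXX.
have sAG : (Mh *m G)^T = Mh *m G.
  rewrite AG; apply: dualmx_eq.
    by rewrite rpartmx_tr rpartmx_dual sAX.
  by rewrite dpartmx_tr dpartmx_dual trmx0.
(* [AGG] yields the core equation and, through [GA], also [G Ah G = G]. *)
by do 2?split; rewrite ?mulmxA ?GA ?AGA ?AGG.
Qed.

End DualInverse.

Lemma dual_sym_parts (S : comNzRingType) n (A B : 'M[S]_n) :
  (dualmx A + eps *: dualmx B)^T = dualmx A + eps *: dualmx B ->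
  A^T = A /\ B^T = B.
Proof.
move=> sAh; split.
  by rewrite -{2}(rpartmx_dual A B) -sAh rpartmx_tr rpartmx_dual.
by rewrite -{2}(dpartmx_dual A B) -sAh dpartmx_tr dpartmx_dual.
Qed.

(** [submx] compares row spaces, hence the transposes: the row space of [A^T] lies in that of the
    stacked matrix, and equal ranks force equality. *)
Lemma rank_row_mx_factor (F : fieldType) m n p (A : 'M[F]_(m, n))
    (B : 'M[F]_(m, p)) :
  \rank (row_mx A B) = \rank A -> exists Y, B = A *m Y.
Proof.
rewrite -mxrank_tr tr_row_mx -[in RHS]mxrank_tr => rAB.
have sub : (A^T <= col_mx A^T B^T)%MS by rewrite -addsmxE addsmxSl.
have : (col_mx A^T B^T <= A^T)%MS.
  by rewrite -(geq_leqif (mxrank_leqif_sup sub)) rAB.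
rewrite -addsmxE addsmx_sub => /andP[_ /submxP[Y eY]].
by exists Y^T; apply: trmx_inj; rewrite trmx_mul trmxK.
Qed.

Lemma rank_row_mx_mul (F : fieldType) m n p (A : 'M[F]_(m, n))
    (Y : 'M[F]_(n, p)) : \rank (row_mx A (A *m Y)) = \rank A.
Proof.
apply/eqP; rewrite eqn_leq -{1}(mulmx1 A) -mul_mx_row mxrankM_maxl.
(* Right multiplication by the block column of [1] and [0] recovers [A], giving the reverse
   inequality. *)
have -> : \rank A = \rank (row_mx A (A *m Y) *m col_mx 1%:M 0).
  by rewrite mul_row_col mulmx1 mulmx0 addr0.
exact: mxrankM_maxl.
Qed.

Theorem theorem3p18 (R : realType) (n : nat) (A B : 'M[R]_n)
    (Ah := dualmx A + eps *: dualmx B : 'M[dual R]_n) (Ah_sym : Ah^T = Ah) :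
  [<->
    (exists Gc Gg Gp : 'M[dual R]_n,
      [/\ is_core_inverse Ah Gc, is_group_inverse Ah Gg & is_mp_inverse Ah Gp]
      /\ [/\ Gc = Gg, Gg = Gp, Gp = mpdgi Ah
           & mpdgi Ah
             = dualmx (mpinv A) - eps *: dualmx (mpinv A *m B *m mpinv A)]);
    [\/ (1%:M - A *m mpinv A) *m B = 0,
        (1%:M - A *m ginv A) *m B = 0
      | (1%:M - A *m cinv A) *m B = 0];
    \rank (row_mx A B) = \rank A;
    (colrange B `<=` colrange A)%classic;
    [\/ B *m (1%:M - A *m mpinv A) = 0,
        B *m (1%:M - A *m ginv A) = 0
      | B *m (1%:M - A *m cinv A) = 0]
  ].
Proof.
have [sA sB] := dual_sym_parts Ah_sym.
have [[AXA _ cAX] _ [_ _ sAX]] := symmx_mpinv sA.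
have sQ : (1%:M - A *m mpinv A)^T = 1%:M - A *m mpinv A.
  by rewrite linearB /= trmx1 sAX.
(* The three projectors agree, so each disjunction becomes one equation repeated. *)
rewrite (symmx_ginv_projector sA) (symmx_cinv_projector sA).
tfae.
- case=> Gc [Gg [Gp [[_ gG _] [_ eg ep _]]]].
  rewrite eg ep in gG; constructor 1.
  exact: (mpdgi_group_inverse_range sA gG).
- move=> QB; have {}QB : (1%:M - A *m mpinv A) *m B = 0 by case: QB.
  move: QB; rewrite mulmxBl mul1mx => /subr0_eq ->.
  by rewrite -mulmxA rank_row_mx_mul.
- move=> /rank_row_mx_factor[Y ->] _ [x _ <-].
  by exists (Y *m x); rewrite // mulmxA.
- move=> sub; constructor 1; apply: trmx_inj.
  rewrite trmx_mul sQ sB trmx0; apply/matrixP => i j.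
  (* Column [j] of [B] has the form [A x], which [1 - A A^+] kills. *)
  have [x _ Ax] : colrange A (B *m delta_mx j 0).
    by apply: sub; exists (delta_mx j 0).
  have /matrixP/(_ i 0) :
      (1%:M - A *m mpinv A) *m B *m delta_mx j 0 = 0 :> 'cV_n.
    by rewrite -mulmxA -Ax mulmxA mulmxBl mul1mx AXA subrr mul0mx.
  by rewrite -colE !mxE.
- move=> BQ; have {}BQ : B *m (1%:M - A *m mpinv A) = 0 by case: BQ.
  (* Transposing [B Q = 0], with [B] and [Q] symmetric, gives [Q B = 0]. *)
  have QB : (1%:M - A *m mpinv A) *m B = 0.
    by rewrite -sQ -sB -trmx_mul BQ trmx0.
  move: BQ QB; rewrite mulmxBr mulmxBl mulmx1 mul1mx => /subr0_eq BP /subr0_eq PB.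
  exists (mpdgi Ah), (mpdgi Ah), (mpdgi Ah); split.
    apply: (mpdgi_inverses sA); first exact: esym PB.
    by rewrite -mulmxA -cAX -BP.
  by split; last exact: mpdgiE.
Qed.
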